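(* For every integer $n\ge 4$, we have $\lambda(\mathbf n)\cong\mathbf 3$, $\Lambda(\mathbf n)\cong\Diamond$, and $L(\mathbf n)\cong\Diamond\sqcup\mathbf 3$. If $P$ is an infinite totally ordered set with $m$ endpoints (so $m\in\{0,1,2\}$ is the number of extreme elements, minimum and maximum, that $P$ has), then $\lambda(P)\cong\mathbf d$ where $d=m+1$.
   Context: For a poset $P$, $\mathrm{Adj}(P)$ is the set of adjoint pairs (monotone Galois connections) $f=(f^*\dashv f_* )$ of monotone maps $f^*,f_*:P\to P$, i.e. $f^*(p)\le q\iff p\le f_*(q)$ for all $p,q\in P$. For posets $P,Q$ and monotone maps $h,k:P\to Q$, say $k$ is taxotopic to $h$, written $k\preceq h$, if there exist $f\in\mathrm{Adj}(P)$ and $g\in\mathrm{Adj}(Q)$ with $k\circ f^*=g^*\circ h$ and $h\circ f_*=g_*\circ k$. This is a preorder on the set $\mathrm{Pos}(P,Q)$ of monotone maps $P\to Q$. The fundamental poset $\Lambda(P,Q)$ is its posetal reflection. Put $\lambda(P):=\Lambda(\mathbf 1,P)$ (so for $p,q\in P$: $p\preceq q$ iff there is $f\in\mathrm{Adj}(P)$ with $f^*(q)=p$ and $f_*(p)=q$), $L(P):=\Lambda(\mathbb Z,P)$ with $\mathbb Z$ the ordered set of integers, and $\Lambda(P):=\Lambda(P,P)$. $\mathbf n$ is the totally ordered set $0<1<\dots<n-1$. $\Diamond$ is the four-element poset $\{\bot,a,b,\top\}$ with $\bot<a,b<\top$ and $a,b$ incomparable. $\sqcup$ denotes disjoint union of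 posets. *)

(* Defs.v *)
From HB Require Import structures.
From mathcomp Require Import all_boot all_order ssralg ssrnum ssrint.
From mathcomp Require Import boolp classical_sets cardinality.
Set Implicit Arguments.
Unset Strict Implicit.
Unset Printing Implicit Defensive.
Import Order.TTheory.
Local Open Scope order_scope.

Definition poset_iso d d' (P : porderType d) (Q : porderType d') : Prop :=
  exists2 f : P -> Q, bijective f & {mono f : x y / x <= y}.

Notation "P ≅ Q" := (poset_iso P Q) (at level 70, no associativity).

Record adj d (P : porderType d) := Adj {
  lstar : {omorphism P -> P};
  rstar : {omorphism P -> P};
  adjP : forall p q, (lstar p <= q) = (p <= rstar q) }.

Section Taxotopy.
Context {d d' : Order.disp_t} (P : porderType d) (Q : porderType d').

Definition pos := {omorphism P -> Q}.

HB.instance Definition _ := gen_eqMixin pos.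
HB.instance Definition _ := gen_choiceMixin pos.

(* taxotopic k h means k ⪯ h: "k is taxotopic to h". *)
Definition taxotopic (k h : pos) : Prop :=
  exists (f : adj P) (g : adj Q),
    k \o lstar f =1 lstar g \o h /\ h \o rstar f =1 rstar g \o k.

End Taxotopy.

Definition adj_id d (P : porderType d) : adj P :=
  @Adj d P idfun idfun (fun _ _ => erefl).

Lemma adj_compP d (P : porderType d) (f g : adj P) p q :
  ((lstar f \o lstar g) p <= q) = (p <= (rstar g \o rstar f) q).
Proof. by rewrite /= !adjP. Qed.

Definition adj_comp d (P : porderType d) (f g : adj P) : adj P :=
  @Adj d P (lstar f \o lstar g) (rstar g \o rstar f) (adj_compP f g).

Section TaxotopyPreorder.
Context {d d' : Order.disp_t} (P : porderType d) (Q : porderType d').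
Local Notation pos := (pos P Q).

Lemma taxotopic_refl (h : pos) : taxotopic h h.
Proof. by exists (adj_id P), (adj_id Q). Qed.

Lemma taxotopic_trans (h k l : pos) :
  taxotopic k h -> taxotopic h l -> taxotopic k l.
Proof.
move=> [f [g [kf hf]]] [f' [g' [hf' lf']]].
exists (adj_comp f f'), (adj_comp g g'); split=> p /=.
  by rewrite [LHS]kf /=; congr (lstar g _); exact: hf'.
by rewrite [LHS]lf' /=; congr (rstar g' _); exact: hf.
Qed.

Fact taxotopy_display : Order.disp_t. Proof. exact: Order.Disp tt tt. Qed.

Definition taxotopicb (k h : pos) : bool := `[< taxotopic k h >].

Fact taxotopicb_refl : reflexive taxotopicb.
Proof. by move=> h; apply/asboolP/taxotopic_refl. Qed.

Fact taxotopicb_trans : transitive taxotopicb.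
Proof.
by move=> h k l /asboolP kh /asboolP hl; apply/asboolP/(taxotopic_trans kh hl).
Qed.

HB.instance Definition _ := Order.Le_isPreorder.Build taxotopy_display pos
  taxotopicb_refl taxotopicb_trans.

End TaxotopyPreorder.

Section PosetalReflection.
Context {d : Order.disp_t} (T : preorderType d).
Local Open Scope quotient_scope.

Definition pequiv (x y : T) : bool := (x <= y) && (y <= x).

Fact pequiv_refl : reflexive pequiv.
Proof. by move=> x; rewrite /pequiv lexx. Qed.
Fact pequiv_sym : symmetric pequiv.
Proof. by move=> x y; rewrite /pequiv andbC. Qed.
Fact pequiv_trans : transitive pequiv.
Proof.
move=> y x z /andP[xy yx] /andP[yz zy].
by rewrite /pequiv (le_trans xy yz) (le_trans zy yx).
Qed.

Definition pequiv_rel := EquivRel pequiv pequiv_refl pequiv_sym pequiv_trans.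

Definition posetal_reflection := {eq_quot pequiv_rel}.

HB.instance Definition _ := Choice.on posetal_reflection.
HB.instance Definition _ := EqQuotient.on posetal_reflection.

Definition reflection_le (x y : posetal_reflection) : bool := repr x <= repr y.

Fact reflection_le_refl : reflexive reflection_le.
Proof. by move=> x; exact: lexx. Qed.
Fact reflection_le_anti : antisymmetric reflection_le.
Proof. by move=> x y xy; rewrite -[x]reprK -[y]reprK; apply/eqmodP. Qed.
Fact reflection_le_trans : transitive reflection_le.
Proof. by move=> y x z; exact: le_trans. Qed.

HB.instance Definition _ := Order.Le_isPOrder.Build d posetal_reflection
  reflection_le_refl reflection_le_anti reflection_le_trans.

(* The order does not depend on the chosen representatives. *)
Lemma le_pi (x y : T) :
  (\pi_posetal_reflection x <= \pi_posetal_reflection y) = (x <= y).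
Proof.
have h z : pequiv (repr (\pi_posetal_reflection z)) z.
  have /eqmodP : repr (\pi_posetal_reflection z) = z %[mod posetal_reflection].
    by rewrite reprK.
  by [].
rewrite [LHS]/Order.le /= /reflection_le.
have /andP[x1 x2] := h x; have /andP[y1 y2] := h y.
apply/idP/idP => xy; first exact: le_trans (le_trans x2 xy) y1.
exact: le_trans (le_trans x1 xy) y2.
Qed.

End PosetalReflection.

Definition Lambda d d' (P : porderType d) (Q : porderType d') :=
  posetal_reflection (pos P Q).
HB.instance Definition _ d d' (P : porderType d) (Q : porderType d') :=
  Order.POrder.on (Lambda P Q).

(* 'I_n is the ordinal n = {0 < ... < n-1}; in particular 'I_1 is the poset 1. *)
Definition lambda d (P : porderType d) := Lambda 'I_1 P.
HB.instance Definition _ d (P : porderType d) := Order.POrder.on (lambda P).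

Definition L d (P : porderType d) := Lambda int P.
HB.instance Definition _ d (P : porderType d) := Order.POrder.on (L P).

Inductive diamond : Type := DBot | DA | DB | DTop.

Definition diamond_le (x y : diamond) : bool :=
  match x, y with
  | DBot, _ | _, DTop | DA, DA | DB, DB => true
  | _, _ => false
  end.

HB.instance Definition _ := gen_eqMixin diamond.
HB.instance Definition _ := gen_choiceMixin diamond.

Fact diamond_display : Order.disp_t. Proof. exact: Order.Disp tt tt. Qed.
Fact diamond_le_refl : reflexive diamond_le. Proof. by case. Qed.
Fact diamond_le_anti : antisymmetric diamond_le. Proof. by case; case. Qed.
Fact diamond_le_trans : transitive diamond_le. Proof. by case; case; case. Qed.

HB.instance Definition _ := Order.Le_isPOrder.Build diamond_display diamond
  diamond_le_refl diamond_le_anti diamond_le_trans.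

Section DisjointUnion.
Context {d d' : Order.disp_t} (P : porderType d) (Q : porderType d').

Definition disjoint_union : Type := P + Q.

HB.instance Definition _ := Choice.on disjoint_union.

Definition disjoint_union_le (x y : disjoint_union) : bool :=
  match x, y with
  | inl p, inl p' => p <= p'
  | inr q, inr q' => q <= q'
  | _, _ => false
  end.

Fact disjoint_union_display : Order.disp_t.
Proof. exact: Order.Disp tt tt. Qed.
Fact disjoint_union_le_refl : reflexive disjoint_union_le.
Proof. by case=> x /=; exact: lexx. Qed.
Fact disjoint_union_le_anti : antisymmetric disjoint_union_le.
Proof. by case=> x [] y //= xy; congr (_ _); exact: le_anti. Qed.
Fact disjoint_union_le_trans : transitive disjoint_union_le.
Proof. by case=> y [] x [] z //=; exact: le_trans. Qed.

HB.instance Definition _ := Order.Le_isPOrder.Build disjoint_union_display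
  disjoint_union
  disjoint_union_le_refl disjoint_union_le_anti disjoint_union_le_trans.

End DisjointUnion.

Definition is_endpoint d (P : porderType d) (x : P) : Prop :=
  (forall y, x <= y) \/ (forall y, y <= x).

(* Main.v *)
From HB Require Import structures.
Require Import Defs.
From mathcomp Require Import all_boot all_order ssralg ssrnum ssrint.
From mathcomp Require Import boolp classical_sets cardinality.
From mathcomp Require Import finmap zify.

Set Implicit Arguments.
Unset Strict Implicit.
Unset Printing Implicit Defensive.
Import Order.TTheory GRing.Theory.
Local Open Scope order_scope.

(** If k is taxotopic to h through (f, g), then k o f^* = g^* o h and
    h o f_* = g_* o k.  Since left adjoints preserve a least element and right
    adjoints a greatest one, k takes the value bottom as soon as h does
    ([taxotopic_hits_bot]), and h takes the value top as soon as k does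
    ([taxotopic_hits_top]).  Everything comes from the fact that, over total
    orders, these are essentially the only obstructions.

    For points p, q of a total order, an adjoint pair with g^* q = p and
    g_* p = q exists exactly when q bottom implies p bottom and p top implies
    q top ([swap_adjP]).  So the interior points are all equivalent, each
    endpoint is a class of its own, and the classes form the chain
    bottom, interior, top with the missing endpoints left out ([lambda_iso]);
    an infinite order always has an interior point.

    For maps between bounded total orders, f can be taken to be the pair of
    constant maps bottom and top, and g a step function; the two booleans
    (hits bottom, hits top) are then complete invariants, whence the diamond
    ([taxotopic_bounded], [Lambda_iso]).

    For maps out of the integers, every adjoint pair is unbounded in both
    directions, so a taxotopy relates the extreme values of the two maps; in
    particular constant and nonconstant maps are never comparable
    ([taxotopic_int_constant]).  Constant maps behave as points.  For two
    nonconstant maps with least and greatest values a < b and c < e, a step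
    function g carries a to c and b to e under the same two conditions, and f is
    chosen to send the ray on which h is a to the ray on which k is c, and the
    ray on which h is b to the ray on which k is e
    ([taxotopic_int_nonconstant]).  All four combinations of the invariants occur
    as soon as there are two interior values ([int_class_surj]). *)

(** * Posetal reflections and adjoint pairs *)

(** A map to a poset that preserves and reflects the preorder, and is onto,
    identifies the posetal reflection with its target. *)
Lemma posetal_reflection_iso d d' (T : preorderType d) (Q : porderType d')
    (c : T -> Q) :
  (forall x y, (c x <= c y) = (x <= y)) -> (forall q, exists x, c x = q) ->
  posetal_reflection T ≅ Q.
Proof.
move=> cmono csurj; pose F (u : posetal_reflection T) := c (repr u).
have Fmono : {mono F : u v / u <= v} by move=> u v; rewrite /F cmono.
have Fpi x : F (\pi_(posetal_reflection T) x)%qT = c x.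
  have /andP[h1 h2] : pequiv (repr (\pi_(posetal_reflection T) x)%qT) x.
    by rewrite /pequiv -(le_pi (repr _)) -(le_pi x) reprK lexx.
  by apply/le_anti; rewrite /F (cmono (repr _)) h1 (cmono x) h2.
exists F => //.
pose G q := (\pi_(posetal_reflection T) (projT1 (cid (csurj q))))%qT.
have FG : cancel G F by move=> q; rewrite Fpi; case: (cid _).
exists G => // u; apply/le_anti.
by rewrite -!Fmono FG lexx.
Qed.

(** A monotone function, bundled as an order morphism. *)
Definition mk_omorphism d d' (P : porderType d) (Q : porderType d') (f : P -> Q)
    (fmono : {homo f : x y / x <= y}) : {omorphism P -> Q} :=
  HB.pack f (Order.isOrderMorphism.Build d P d' Q f fmono).

(** Both components of a Galois connection are automatically monotone. *)
Lemma galois_adj d (P : porderType d) (f g : P -> P) :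
  (forall p q, (f p <= q) = (p <= g q)) ->
  exists F : adj P, lstar F =1 f /\ rstar F =1 g.
Proof.
move=> fg.
have fmono : {homo f : x y / x <= y}.
  by move=> x y xy; rewrite fg (le_trans xy)// -fg.
have gmono : {homo g : x y / x <= y}.
  by move=> x y xy; rewrite -fg (le_trans _ xy)// fg.
by exists (@Adj d P (mk_omorphism fmono) (mk_omorphism gmono) fg).
Qed.

(** Least and greatest elements, as properties of a point: the orders considered
    need not have such elements. *)
Definition is_bot d (P : porderType d) (x : P) : Prop := forall y, x <= y.
Definition is_top d (P : porderType d) (x : P) : Prop := forall y, y <= x.

Lemma is_bot_uniq d (P : porderType d) (x y : P) : is_bot x -> is_bot y -> x = y.
Proof. by move=> xb yb; apply/le_anti; rewrite xb yb. Qed.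

Lemma is_top_uniq d (P : porderType d) (x y : P) : is_top x -> is_top y -> x = y.
Proof. by move=> xt yt; apply/le_anti; rewrite xt yt. Qed.

Lemma lstar_bot d (P : porderType d) (F : adj P) x :
  is_bot x -> is_bot (lstar F x).
Proof. by move=> xb y; rewrite adjP. Qed.

Lemma rstar_top d (P : porderType d) (F : adj P) x :
  is_top x -> is_top (rstar F x).
Proof. by move=> xt y; rewrite -adjP. Qed.

Lemma not_bot_exists_lt d (P : orderType d) (x : P) :
  ~ is_bot x -> exists y, y < x.
Proof. by move=> /existsNP[y /negP]; rewrite -ltNge; exists y. Qed.

Lemma not_top_exists_gt d (P : orderType d) (x : P) :
  ~ is_top x -> exists y, x < y.
Proof. by move=> /existsNP[y /negP]; rewrite -ltNge; exists y. Qed.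

(** [le_chain] proves x <= y by following a chain of hypotheses; each one is used
    at most once, which bounds the search. [order_contra] closes a goal whose
    order hypotheses contain a cycle through a strict inequality, and
    [order_cases] splits on every comparison in the goal and discards the
    contradictory branches. *)
Ltac le_chain := match goal with
  | |- is_true (?x <= ?x) => exact: lexx
  | H : is_bot ?x |- is_true (?x <= _) => exact: H
  | H : is_top ?y |- is_true (_ <= ?y) => exact: H
  | Ht : is_top ?t, H : is_true (?t <= ?y) |- is_true (_ <= ?y) =>
      exact: le_trans (Ht _) H
  | H : is_true (?x <= ?y) |- is_true (?x <= ?y) => exact: H
  | H : is_true (?x < ?y) |- is_true (?x <= ?y) => exact: ltW H
  | H : is_true (?x <= ?z) |- is_true (?x <= _) =>
      refine (le_trans H _); clear H; le_chain
  | H : is_true (?x < ?z) |- is_true (?x <= _) =>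
      refine (le_trans (ltW H) _); clear H; le_chain
  end.

Ltac order_contra := exfalso; match goal with
  | H : is_true (?x < ?y) |- False =>
      suff: y <= x; [by rewrite leNgt H | clear H; le_chain]
  end.

Ltac order_cases :=
  repeat (match goal with
  | |- context [if ?x <= ?y then _ else _] => case: (leP x y) => ?
  | |- context [if ?x < ?y then _ else _] => case: (ltP x y) => ?
  end);
  repeat match goal with
  | |- context [?x <= ?y] => case: (leP x y) => ? //
  end => //; try order_contra.

(** The left adjoint collapses the interval [p, q] onto p. *)
Lemma collapse_adj d (P : orderType d) (p q : P) : p <= q ->
  exists F : adj P, lstar F q = p /\ rstar F p = q.
Proof.
move=> pq.
case: (@galois_adj d P
  (fun x => if x <= p then x else if x <= q then p else x)
  (fun y => if y < p then y else if y <= q then q else y)) => [|F [Fl Fr]].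
  by move=> x y /=; order_cases.
exists F; rewrite Fl Fr lexx ltxx pq; split=> //.
by case: (leP q p) => // qp; apply/le_anti; rewrite pq qp.
Qed.

(** Moving q up to p >= q. A point q' below q and a point p' above p leave room
    for the adjunction: only (q', q] is sent to p, only (q, p'] to p', and the
    other points are fixed. Without q' the right adjoint would require a
    supremum of the points below q. *)
Lemma expand_adj d (P : orderType d) (p q q' p' : P) :
  q' < q -> q <= p -> p < p' ->
  exists F : adj P, lstar F q = p /\ rstar F p = q.
Proof.
move=> q'q qp pp'.
case: (@galois_adj d P
  (fun x => if x <= q' then x else if x <= q then p else
            if x <= p' then p' else x)
  (fun y => if y < q' then y else if y < p then q' else
            if y < p' then q else y)) => [|F [Fl Fr]].
  by move=> x y /=; order_cases.
exists F; rewrite Fl Fr lexx ltxx pp'; split; order_cases => //; order_contra.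
Qed.

(** A left adjoint with at most four values, sending (bot, a] to c and (a, b] to
    e. In particular a is sent to c unless a is bot, and e is sent back to b
    unless e is top. *)
Lemma step_adj d (P : orderType d) (bot top a b c e : P) :
  is_bot bot -> is_top top -> a <= b -> c <= e ->
  exists F : adj P,
    lstar F =1 (fun x => if x <= bot then bot else if x <= a then c else
                         if x <= b then e else top) /\
    rstar F =1 (fun y => if y < c then bot else if y < e then a else
                         if y < top then b else top).
Proof.
move=> botP topP ab ce; apply: galois_adj => x y.
order_cases.
Qed.

(** * Points of a total order *)

(** Taxotopy between points p and q of a total order. *)
Lemma swap_adjP d (P : orderType d) (p q : P) :
  (exists F : adj P, lstar F q = p /\ rstar F p = q) <->
  (is_bot q -> is_bot p) /\ (is_top p -> is_top q).
Proof.
split=> [[F [qp pq]]|[botqp toppq]].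
  split=> [qb|pt]; first by rewrite -qp; exact: lstar_bot.
  by rewrite -pq; exact: rstar_top.
case: (leP p q) => [|qp]; first exact: collapse_adj.
have [q' q'q] : exists q', q' < q.
  by apply: not_bot_exists_lt => /botqp/(_ q); rewrite leNgt qp.
have [p' pp'] : exists p', p < p'.
  by apply: not_top_exists_gt => /toppq/(_ p); rewrite leNgt qp.
exact: expand_adj q'q (ltW qp) pp'.
Qed.

(** Whether P has a least, resp. a greatest, element, as a boolean, so that it
    can be counted. *)
Definition has_bot d (P : porderType d) : bool := `[<exists x : P, is_bot x>].
Definition has_top d (P : porderType d) : bool := `[<exists x : P, is_top x>].

(** The number of endpoints of P; if P has a single point, that point counts
    twice. *)
Definition nb_endpoints d (P : porderType d) : nat := (has_bot P + has_top P)%N.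

(** The position of the class of x in the chain of classes of points: bottom,
    interior, top, skipping the endpoints that P does not have. This is meaningful when P has an
    interior point. *)
Definition rank d (P : porderType d) (x : P) : nat :=
  ((has_bot P && ~~ `[<is_bot x>]) + `[<is_top x>])%N.

(** Points other than the endpoints. *)
Definition interior d (P : porderType d) (x : P) : Prop :=
  ~ is_bot x /\ ~ is_top x.

Lemma interior_not_bot_top d (P : porderType d) (z x : P) :
  interior z -> is_bot x -> ~ is_top x.
Proof.
move=> [zb _] xb xt; apply: zb => y.
by rewrite (le_trans (xt z)).
Qed.

Lemma rank_le d (P : porderType d) (z : P) (p q : P) : interior z ->
  (rank p <= rank q)%N = `[<(is_bot q -> is_bot p) /\ (is_top p -> is_top q)>].
Proof.
move=> zi; rewrite /rank asbool_and !asbool_imply.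
have hb (x : P) : `[<is_bot x>] -> has_bot P.
  by move=> /asboolP ?; apply/asboolP; exists x.
have hbt (x : P) : `[<is_bot x>] -> ~~ `[<is_top x>].
  by move=> /asboolP xb; apply/asboolP; exact: interior_not_bot_top zi xb.
move: (hb p) (hb q) (hbt p) (hbt q).
by case: (has_bot P); case: `[<is_bot p>]; case: `[<is_top p>];
  case: `[<is_bot q>]; case: `[<is_top q>] => //= h1 h2 h3 h4;
  try (by have := h1 isT); try (by have := h2 isT); try (by have := h3 isT);
  try (by have := h4 isT).
Qed.

Lemma rank_bound d (P : porderType d) (z x : P) : interior z ->
  (rank x < (nb_endpoints P).+1)%N.
Proof.
move=> zi; rewrite ltnS /rank /nb_endpoints.
apply: leq_add; first by case: has_bot; case: asbool.
by case: asboolP => // xt; rewrite /has_top; case: asboolP => // -[]; exists x.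
Qed.

Lemma rank_surj d (P : porderType d) (z : P) (i : nat) : interior z ->
  (i <= nb_endpoints P)%N -> exists x : P, rank x = i.
Proof.
move=> zi; have [zb zt] := zi.
have rz : rank z = has_bot P.
  by rewrite /rank (introF (asboolP _) zb) (introF (asboolP _) zt) andbT addn0.
have rb (x : P) : is_bot x -> rank x = 0.
  move=> xb; rewrite /rank (introT (asboolP _) xb) andbF.
  by rewrite (introF (asboolP _) (interior_not_bot_top zi xb)).
have rt (x : P) : is_top x -> rank x = (has_bot P).+1.
  move=> xt; rewrite /rank (introT (asboolP _) xt) addn1.
  by rewrite (introF (asboolP _) (fun xb => interior_not_bot_top zi xb xt)) andbT.
rewrite /nb_endpoints; case: (ltngtP i (has_bot P)) => [|lt|->]; last by exists z.
  case E: (has_bot P) => // + _; rewrite ltnS leqn0 => /eqP ->.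
  by have /asboolP[x xb] := E; exists x; exact: rb.
case E: (has_top P) => le; last by move: le; rewrite addn0 leqNgt lt.
have /asboolP[x xt] := E; exists x; rewrite rt //.
by apply/eqP; rewrite eqn_leq lt -addn1.
Qed.

(** Maps taking a single value. *)
Definition constant_map d d' (P : porderType d) (Q : porderType d')
  (h : pos P Q) : Prop := forall x y, h x = h y.

(** Between constant maps, taxotopy is the relation between their values. *)
Lemma taxotopic_constant d d' (P : porderType d) (Q : porderType d')
    (x0 : P) (k h : pos P Q) : constant_map k -> constant_map h ->
  taxotopic k h <->
  exists G : adj Q, lstar G (h x0) = k x0 /\ rstar G (k x0) = h x0.
Proof.
move=> kc hc; split=> [[F [G [kF hF]]]|[G [hk kh]]].
  exists G; split; first by rewrite -[LHS]kF; exact: kc.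
  by rewrite -[LHS]hF; exact: hc.
exists (adj_id P), G; split=> x /=.
  by rewrite (hc _ x0) hk.
by rewrite (kc _ x0) kh.
Qed.

Lemma lambda_iso d (P : orderType d) (z : P) : interior z ->
  lambda P ≅ 'I_(nb_endpoints P).+1.
Proof.
move=> zi.
have inordE (x : P) : (inord (rank x) : 'I_(nb_endpoints P).+1) = rank x :> nat.
  by rewrite inordK// (rank_bound x zi).
apply: (@posetal_reflection_iso _ _ (pos 'I_1 P) _
  (fun h => inord (rank (h ord0)))) => [k h|i].
  have kc (l : pos 'I_1 P) : constant_map l.
    by move=> x y; rewrite (ord1 x) (ord1 y).
  rewrite leEord inordE inordE (rank_le _ _ zi).
  by apply: asbool_equiv_eq; rewrite (taxotopic_constant ord0)// swap_adjP.
have [x rx] := rank_surj zi (ltn_ord i : (i <= nb_endpoints P)%N).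
exists (mk_omorphism (fun (_ _ : 'I_1) _ => lexx x)).
by apply: val_inj; rewrite /= inordE.
Qed.

(** * Counting the endpoints *)

Lemma interior_exists d (P : porderType d) :
  infinite_set [set: P]%classic ->
  finite_set [set x : P | is_endpoint x]%classic -> exists z : P, interior z.
Proof.
move=> Pinf Efin; apply: contrapT => /forallNP noint; apply: Pinf.
apply: sub_finite_set Efin => x _ /=; apply: contrapT => /not_orP.
exact: noint.
Qed.

(** The interior point guarantees that a least and a greatest element are
    distinct. *)
Lemma card_endpoints d (P : porderType d) (z : P) : interior z ->
  ([set x : P | is_endpoint x] #= `I_(nb_endpoints P))%card.
Proof.
move=> zi; rewrite /nb_endpoints /has_bot /has_top.
case: asboolP => [[b bP]|nb]; case: asboolP => [[t tP]|nt].
- have -> : [set x | is_endpoint x]%classic = [set` [fset b; t]%fset]%classic.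
    apply/seteqP; split=> x /=; rewrite !inE.
      by move=> [xb|xt]; apply/orP; [left|right]; apply/eqP;
        [exact: is_bot_uniq|exact: is_top_uniq].
    by move=> /orP[] /eqP->; [left|right].
  apply/card_eq_fsetP; rewrite cardfs2.
  suff -> : b != t by [].
  by apply/eqP => bt; apply: (interior_not_bot_top zi bP); rewrite bt.
- have -> : [set x | is_endpoint x]%classic = [set b]%classic.
    apply/seteqP; split=> x /=; last by move=> ->; left.
    by move=> [xb|xt]; [exact: is_bot_uniq|case: nt; exists x].
  exact: card_set1.
- have -> : [set x | is_endpoint x]%classic = [set t]%classic.
    apply/seteqP; split=> x /=; last by move=> ->; right.
    by move=> [xb|xt]; [case: nb; exists x|exact: is_top_uniq].
  exact: card_set1.
- have -> : [set x : P | is_endpoint x]%classic = set0.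
    apply/seteqP; split=> x //= -[xb|xt]; first by case: nb; exists x.
    by case: nt; exists x.
  by rewrite II0 card_eq0.
Qed.

Lemma lambda_infinite d (P : orderType d) (m : nat) :
  infinite_set [set: P]%classic ->
  ([set x : P | is_endpoint x]%classic #= `I_m)%card ->
  (m <= 2)%N /\ lambda P ≅ 'I_m.+1.
Proof.
move=> Pinf Em.
have [z zi] : exists z : P, interior z.
  by apply: interior_exists Pinf _; exists m.
have <- : nb_endpoints P = m.
  by apply/card_eq_II; rewrite -(card_eql (card_endpoints zi)).
split; last exact: lambda_iso zi.
by rewrite /nb_endpoints; case: has_bot; case: has_top.
Qed.

(** * Maps between bounded total orders *)

(** The two invariants of a map under taxotopy: whether the least, resp. the
    greatest, element of the codomain is a value. *)
Definition hits_bot d d' (P : porderType d) (Q : porderType d') (h : pos P Q)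
  : Prop := exists x, is_bot (h x).

Definition hits_top d d' (P : porderType d) (Q : porderType d') (h : pos P Q)
  : Prop := exists x, is_top (h x).

Lemma taxotopic_hits_bot d d' (P : porderType d) (Q : porderType d')
  (k h : pos P Q) : taxotopic k h -> hits_bot h -> hits_bot k.
Proof.
move=> [F [G [kF _]]] [x hx]; exists (lstar F x).
by rewrite [k _]kF; exact: lstar_bot.
Qed.

Lemma taxotopic_hits_top d d' (P : porderType d) (Q : porderType d')
  (k h : pos P Q) : taxotopic k h -> hits_top k -> hits_top h.
Proof.
move=> [F [G [_ hF]]] [x kx]; exists (rstar F x).
by rewrite [h _]hF; exact: rstar_top.
Qed.

(** The class of a map, given whether it hits bottom (b) and top (t). Hitting
    bottom lowers the class and hitting top raises it. *)
Definition diamond_of (b t : bool) : diamond :=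
  match b, t with
  | true, false => DBot
  | false, false => DA
  | true, true => DB
  | false, true => DTop
  end.

Definition diamond_class d d' (P : porderType d) (Q : porderType d')
  (h : pos P Q) : diamond := diamond_of `[<hits_bot h>] `[<hits_top h>].

Lemma diamond_classE d d' (P : porderType d) (Q : porderType d')
    (h : pos P Q) (b t : bool) :
  reflect (hits_bot h) b -> reflect (hits_top h) t ->
  diamond_class h = diamond_of b t.
Proof.
move=> hb ht; rewrite /diamond_class.
by rewrite (asbool_equiv_eqP hb) ?(asbool_equiv_eqP ht).
Qed.

Lemma diamond_class_le d d' (P : porderType d) (Q : porderType d')
    (k h : pos P Q) :
  (diamond_class k <= diamond_class h) =
  `[<(hits_bot h -> hits_bot k) /\ (hits_top k -> hits_top h)>].
Proof.
rewrite asbool_and !asbool_imply /diamond_class /diamond_of.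
by case: `[<hits_bot k>]; case: `[<hits_top k>];
  case: `[<hits_bot h>]; case: `[<hits_top h>].
Qed.

Lemma lt_not_bot d (P : porderType d) (x y : P) : x < y -> ~ is_bot y.
Proof. by move=> xy /(_ x); apply/negP; rewrite lt_geF. Qed.

Lemma lt_not_top d (P : porderType d) (x y : P) : x < y -> ~ is_top x.
Proof. by move=> xy /(_ y); apply/negP; rewrite lt_geF. Qed.

Lemma taxotopic_bounded d d' (P : porderType d) (Q : orderType d')
    (x0 x1 : P) (bot top : Q) (k h : pos P Q) :
  is_bot x0 -> is_top x1 -> is_bot bot -> is_top top ->
  taxotopic k h <->
  (hits_bot h -> hits_bot k) /\ (hits_top k -> hits_top h).
Proof.
move=> x0P x1P botP topP; split.
  by move=> kh; split; [exact: taxotopic_hits_bot|exact: taxotopic_hits_top].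
move=> [bkh tkh].
(* The constant pair reduces the two equations to g^* = k x0 on the range of h
   and g_* = h x1 on the range of k. *)
have [F [Fl Fr]] : exists F : adj P, lstar F =1 (fun _ => x0) /\
    rstar F =1 (fun _ => x1).
  by apply: galois_adj => p q; rewrite x0P x1P.
have [G [Gl Gr]] := step_adj botP topP (lexx (h x1)) (lexx (k x0)).
exists F, G; split=> x /=; rewrite ?Fl ?Fr ?Gl ?Gr.
  have hx1 : h x <= h x1 by apply: omorph_le; exact: x1P.
  case: leP => [hb|_]; last by rewrite hx1.
  have [|y ky] := bkh.
    by exists x => z; exact: le_trans hb (botP z).
  apply/le_anti; rewrite botP andbT.
  apply: le_trans (ky bot); apply: omorph_le; exact: x0P.
have hx0 : k x0 <= k x by apply: omorph_le; exact: x0P.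
rewrite ltNge hx0 /=; case: ltP => [//|kt].
have [|y hy] := tkh.
  by exists x => z; exact: le_trans (topP z) kt.
apply/le_anti; rewrite topP /=.
by apply: le_trans (hy top) _; apply: omorph_le; exact: x1P.
Qed.

Lemma Lambda_iso d (P : orderType d) (bot u top : P) :
  is_bot bot -> is_top top -> bot < u -> u < top -> Lambda P P ≅ diamond.
Proof.
move=> botP topP bu ut.
have ub := lt_not_bot bu; have ut' := lt_not_top ut.
have bt := lt_not_top bu; have tb := lt_not_bot ut.
apply: (@posetal_reflection_iso _ _ (pos P P) _ (@diamond_class _ _ P P)) =>
  [k h|q].
  rewrite diamond_class_le; apply: asbool_equiv_eq.
  by rewrite (taxotopic_bounded k h botP topP botP topP).
have cst (x : P) (b t : bool) : reflect (is_bot x) b -> reflect (is_top x) t ->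
    exists h : pos P P, diamond_class h = diamond_of b t.
  move=> xb xt; exists (mk_omorphism (fun _ _ _ => lexx x)).
  apply: diamond_classE.
    by apply: (equivP xb); split=> [?|[]//]; exists bot.
  by apply: (equivP xt); split=> [?|[]//]; exists bot.
case: q.
- exact: (cst bot true false (ReflectT _ botP) (ReflectF _ bt)).
- exact: (cst u false false (ReflectF _ ub) (ReflectF _ ut')).
- exists (idfun : {omorphism P -> P}).
  apply: (diamond_classE (ReflectT _ _) (ReflectT _ _)); first by exists bot.
  by exists top.
- exact: (cst top false true (ReflectF _ tb) (ReflectT _ topP)).
Qed.

(** * Maps from the integers *)

(** A nonempty, proper up-set of the integers is a ray. *)
Lemma int_threshold (p : pred int) (x0 x1 : int) :
  (forall x y, x <= y -> p x -> p y) -> ~~ p x0 -> p x1 ->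
  exists N : int, forall x, p x = (N < x).
Proof.
move=> pmono np0 p1.
have x01 : x0 <= x1.
  by rewrite leNgt; apply: contra np0 => /ltW/pmono; apply.
have ex : exists n : nat, p (x0 + n%:Z)%R.
  exists `|x1 - x0|%N; suff -> : (x0 + `|x1 - x0|%N%:Z)%R = x1 by [].
  by lia.
have [n pn nmin] := ex_minnP ex.
exists (x0 + n%:Z - 1)%R => x; apply/idP/idP => [px|Nx].
  rewrite ltNge; apply/negP => xN.
  case: n pn nmin xN => [|n] pn nmin xN.
    by move/negP: np0; apply; rewrite addr0 in pn.
  have /nmin : p (x0 + n%:Z)%R.
    by apply: pmono px; lia.
  by rewrite ltnn.
by apply: pmono pn; lia.
Qed.

(** The range of h has a least and a greatest element. *)
Definition attains_bounds d d' (P : porderType d) (Q : porderType d')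
  (h : pos P Q) : Prop :=
  (exists x, forall y, h x <= h y) /\ (exists x, forall y, h y <= h x).

Lemma lstar_int_unbounded (F : adj int) (y : int) : exists x, y <= lstar F x.
Proof.
exists (rstar F y + 1)%R.
have := adjP F (rstar F y + 1)%R y; lia.
Qed.

Lemma rstar_int_unbounded (F : adj int) (y : int) : exists x, rstar F x <= y.
Proof.
exists (lstar F y - 1)%R.
have := adjP F y (lstar F y - 1)%R; lia.
Qed.

(** Since f^* is cofinal and coinitial, every value of k lies between two values
    of k o f^* = g^* o h; symmetrically for h and f_*. *)
Lemma taxotopic_int_constant d (Q : porderType d) (k h : pos int Q) :
  taxotopic k h -> constant_map k <-> constant_map h.
Proof.
move=> [F [G [kF hF]]]; split=> [kc|hc].
  have hFc x : h (rstar F x) = h (rstar F 0%R).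
    by rewrite [LHS]hF [RHS]hF /= (kc x 0%R).
  suff hE x : h x = h (rstar F 0%R) by move=> x y; rewrite !hE.
  have [y yx] := rstar_int_unbounded F x.
  apply/le_anti; rewrite -{2}(hFc y) (omorph_le h yx) andbT.
  by rewrite -(hFc (lstar F x)) omorph_le// -adjP.
have kFc x : k (lstar F x) = k (lstar F 0%R).
  by rewrite [LHS]kF [RHS]kF /= (hc x 0%R).
suff kE x : k x = k (lstar F 0%R) by move=> x y; rewrite !kE.
have [y xy] := lstar_int_unbounded F x.
apply/le_anti; rewrite -{1}(kFc y) (omorph_le k xy) /=.
by rewrite -(kFc (rstar F x)) omorph_le// adjP.
Qed.

(** The left adjoint translates (-oo, N] onto (-oo, M] and [N2 + 1, +oo) onto
    [M2 + 1, +oo); whatever is in between goes to M2 + 1. *)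
Lemma int_stretch_adj (N N2 M M2 : int) : N <= N2 -> M <= M2 ->
  exists F : adj int,
    lstar F =1 (fun x => if x <= N then (x - N + M)%R else
                         if x <= N2 then (M2 + 1)%R else (x - N2 + M2)%R) /\
    rstar F =1 (fun y => if y <= M then (y - M + N)%R else
                         if y <= M2 then N else (y - M2 + N2)%R).
Proof.
by move=> *; apply: galois_adj => x y;
  case: (leP x N) => ?; case: (leP x N2) => ?;
  case: (leP y M) => ?; case: (leP y M2) => ?; lia.
Qed.

(** A nonconstant map attaining its bounds leaves its least value after N, and
    reaches its greatest one after N2. *)
Lemma int_jumps d (Q : orderType d) (h : pos int Q) (x0 x1 : int) :
  ~ constant_map h ->
  (forall y, h x0 <= h y) -> (forall y, h y <= h x1) ->
  h x0 < h x1 /\ exists N N2 : int, [/\ N <= N2,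
    forall x, (h x0 < h x) = (N < x) & forall x, (h x1 <= h x) = (N2 < x)].
Proof.
move=> hnc hx0 hx1.
have lt01 : h x0 < h x1.
  rewrite ltNge; apply/negP => le10; apply: hnc.
  have le_h x y : h x <= h y := le_trans (hx1 x) (le_trans le10 (hx0 y)).
  by move=> x y; apply/le_anti; rewrite (le_h x) (le_h y).
have lo_up x y : x <= y -> h x0 < h x -> h x0 < h y.
  by move=> xy hx; exact: lt_le_trans hx (omorph_le h xy).
have hi_up x y : x <= y -> h x1 <= h x -> h x1 <= h y.
  by move=> xy hx; exact: le_trans hx (omorph_le h xy).
have lo0 : ~~ (h x0 < h x0) by rewrite ltxx.
have hi0 : ~~ (h x1 <= h x0) by rewrite -ltNge.
have [N NP] := int_threshold lo_up lo0 lt01.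
have [N2 N2P] := int_threshold hi_up hi0 (lexx (h x1)).
split=> //; exists N, N2; split=> //.
have : N < (N2 + 1)%R by rewrite -NP (lt_le_trans lt01)// N2P; lia.
by lia.
Qed.

Lemma taxotopic_int_nonconstant d (Q : orderType d) (bot top : Q)
    (k h : pos int Q) :
  is_bot bot -> is_top top -> attains_bounds k -> attains_bounds h ->
  ~ constant_map k -> ~ constant_map h ->
  taxotopic k h <->
  (hits_bot h -> hits_bot k) /\ (hits_top k -> hits_top h).
Proof.
move=> botP topP [[y0 ky0] [y1 ky1]] [[x0 hx0] [x1 hx1]] knc hnc; split.
  by move=> kh; split; [exact: taxotopic_hits_bot|exact: taxotopic_hits_top].
move=> [bkh tkh].
have [h01 [N [N2 [NN2 NP N2P]]]] := int_jumps hnc hx0 hx1.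
have [k01 [M [M2 [MM2 MP M2P]]]] := int_jumps knc ky0 ky1.
have [F [Fl Fr]] := int_stretch_adj NN2 MM2.
have [G [Gl Gr]] := step_adj botP topP (ltW h01) (ltW k01).
have kbot : h x0 <= bot -> k y0 = bot.
  move=> h0; have [|y ky] := bkh.
    by exists x0 => z; exact: le_trans h0 (botP z).
  by apply/le_anti; rewrite botP (le_trans (ky0 y) (ky bot)).
have htop : top <= k y1 -> h x1 = top.
  move=> k1; have [|x hx] := tkh.
    by exists y1 => z; exact: le_trans (topP z) k1.
  by apply/le_anti; rewrite topP (le_trans (hx top) (hx1 x)).
have k_low y : y <= M -> k y = k y0.
  by move=> yM; apply/le_anti; rewrite ky0 andbT leNgt MP -leNgt.
have k_high y : M2 < y -> k y = k y1.
  by move=> yM; apply/le_anti; rewrite ky1 M2P.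
have h_low x : x <= N -> h x = h x0.
  by move=> xN; apply/le_anti; rewrite hx0 andbT leNgt NP -leNgt.
have h_high x : N2 < x -> h x = h x1.
  by move=> xN; apply/le_anti; rewrite hx1 N2P.
exists F, G; split=> x /=; rewrite ?Fl ?Fr ?Gl ?Gr.
  case: (leP x N) => xN.
    rewrite k_low; last by lia.
    by rewrite h_low// lexx; case: leP => // /kbot.
  rewrite k_high; last by case: (leP x N2) => ?; lia.
  have hx : h x0 < h x by rewrite NP.
  by rewrite !leNgt hx (le_lt_trans (botP (h x0)) hx) /= ltNge hx1.
case: (leP x M) => xM.
  rewrite h_low; last by lia.
  by rewrite k_low// ltxx k01.
case: (leP x M2) => xM2.
  rewrite h_low//.
  have kx : k x < k y1 by rewrite ltNge M2P -leNgt.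
  by rewrite kx ltNge ky0.
rewrite h_high; last by lia.
rewrite k_high// ltxx ltNge ky0 /=.
by case: ltP => // /htop.
Qed.

(** The class of a map from the integers: a constant one is classified by the
    rank of its value, a nonconstant one by the two invariants. *)
Definition int_class d (Q : porderType d) (h : pos int Q) :
    disjoint_union diamond 'I_(nb_endpoints Q).+1 :=
  if `[<constant_map h>] then inr (inord (rank (h 0%R)))
  else inl (diamond_class h).

Lemma int_class_le d (Q : orderType d) (bot top z : Q) (k h : pos int Q) :
  (forall h : pos int Q, attains_bounds h) ->
  is_bot bot -> is_top top -> interior z ->
  (int_class k <= int_class h) = `[<taxotopic k h>].
Proof.
move=> att botP topP zi.
pose I := 'I_(nb_endpoints Q).+1; pose U := disjoint_union diamond I.
have inlE (x y : diamond) : (inl x <= inl y :> U) = (x <= y) by [].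
have inrE (x y : Q) : (inr (inord (rank x)) <= inr (inord (rank y)) :> U) =
    `[<(is_bot y -> is_bot x) /\ (is_top x -> is_top y)>].
  rewrite -(rank_le _ _ zi) -[LHS]/((inord (rank x) : I) <= (inord (rank y) : I)).
  by rewrite leEord !inordK ?(rank_bound _ zi).
apply/idP/idP; rewrite /int_class.
  case: asboolP => kc; case: asboolP => hc //.
    rewrite inrE => /asboolP/swap_adjP kh; apply/asboolP.
    exact/(taxotopic_constant 0%R).
  rewrite inlE diamond_class_le => /asboolP kh.
  exact/asboolP/(taxotopic_int_nonconstant botP topP).
move=> /asboolP kh; have khc := taxotopic_int_constant kh.
case: asboolP => kc; case: asboolP => hc.
- rewrite inrE; apply/asboolP/swap_adjP.
  exact/(taxotopic_constant 0%R).
- by case: hc; apply/khc.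
- by case: kc; apply/khc.
- rewrite inlE diamond_class_le.
  exact/asboolP/(taxotopic_int_nonconstant botP topP).
Qed.

(** The function with value u on negative integers and v elsewhere. *)
Lemma two_step_mono d (Q : porderType d) (u v : Q) : u <= v ->
  {homo (fun x : int => if x < 0%R then u else v) : x y / x <= y}.
Proof.
move=> uv x y xy /=; case: (ltP y) => [y0|_].
  by rewrite (le_lt_trans xy y0).
by case: ifP.
Qed.

Lemma int_class_surj d (Q : porderType d) (bot u v top : Q) q :
  is_bot bot -> is_top top -> bot < u -> u < v -> v < top ->
  exists h : pos int Q, int_class h = q.
Proof.
move=> botP topP bu uv vt.
have ui : interior u by split; [exact: lt_not_bot bu|exact: lt_not_top uv].
have step (s t : Q) (b c : bool) : s < t ->
    reflect (is_bot s) b -> reflect (is_top t) c ->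
    exists h : pos int Q, int_class h = inl (diamond_of b c).
  move=> st sb tc; pose h : pos int Q := mk_omorphism (two_step_mono (ltW st)).
  have hc : ~ constant_map h.
    by move=> /(_ (-1)%R 0%R) /= E; have := st; rewrite E ltxx.
  exists h; rewrite /int_class (introF (asboolP _) hc); congr inl.
  apply: diamond_classE.
    apply: (equivP sb); split=> [?|[x]]; first by exists (-1)%R.
    by rewrite /=; case: ifP => // _ /(lt_not_bot st).
  apply: (equivP tc); split=> [?|[x]]; first by exists 0%R.
  by rewrite /=; case: ifP => // _ /(lt_not_top st).
case: q => [[]|i].
- exact: (step _ _ true false (lt_trans bu uv) (ReflectT _ botP)
    (ReflectF _ (lt_not_top vt))).
- exact: (step _ _ false false uv (ReflectF _ (lt_not_bot bu))
    (ReflectF _ (lt_not_top vt))).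
- exact: (step _ _ true true (lt_trans bu (lt_trans uv vt)) (ReflectT _ botP)
    (ReflectT _ topP)).
- exact: (step _ _ false true (lt_trans uv vt) (ReflectF _ (lt_not_bot bu))
    (ReflectT _ topP)).
have [x rx] := rank_surj ui (ltn_ord i : (i <= nb_endpoints Q)%N).
pose h : pos int Q := mk_omorphism (fun (_ _ : int) _ => lexx x).
have hc : constant_map h by [].
exists h; rewrite /int_class (introT (asboolP _) hc); congr inr.
by apply: val_inj; rewrite /= inordK rx.
Qed.

Lemma L_iso d (Q : orderType d) (bot u v top : Q) :
  (forall h : pos int Q, attains_bounds h) ->
  is_bot bot -> is_top top -> bot < u -> u < v -> v < top ->
  L Q ≅ disjoint_union diamond 'I_(nb_endpoints Q).+1.
Proof.
move=> att botP topP bu uv vt.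
apply: (@posetal_reflection_iso _ _ (pos int Q) _ (@int_class _ Q)) => [k h|q].
  have ui : interior u by split; [exact: lt_not_bot bu|exact: lt_not_top uv].
  exact: int_class_le att botP topP ui.
exact: int_class_surj botP topP bu uv vt.
Qed.

(** * Finite total orders *)

Lemma attains_bounds_finite d d' (P : porderType d) (Q : finOrderType d') (x0 : P)
  (h : pos P Q) : attains_bounds h.
Proof.
pose V : pred Q := fun v => `[<exists x, h x = v>].
have V0 : V (h x0) by apply/asboolP; exists x0.
have Vh y : V (h y) by apply/asboolP; exists y.
split.
  case: (@arg_minP _ _ _ (h x0) V id V0) => _ /asboolP[x <-] xmin.
  by exists x => y; apply: xmin.
case: (@arg_maxP _ _ _ (h x0) V id V0) => _ /asboolP[x <-] xmax.
by exists x => y; apply: xmax.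
Qed.

Lemma nb_endpoints2 d (P : porderType d) (bot top : P) :
  is_bot bot -> is_top top -> nb_endpoints P = 2.
Proof.
move=> botP topP; rewrite /nb_endpoints /has_bot /has_top.
by rewrite !(introT (asboolP _))//; [exists top|exists bot].
Qed.

Theorem corollary5p5 :
  (forall n : nat, (4 <= n)%N ->
     [/\ lambda 'I_n ≅ 'I_3,
         Lambda 'I_n 'I_n ≅ diamond
       & L 'I_n ≅ disjoint_union diamond 'I_3]) /\
  (forall (d : Order.disp_t) (P : orderType d) (m : nat),
     infinite_set [set: P]%classic ->
     ([set x : P | is_endpoint x]%classic #= `I_m)%card ->
     (m <= 2)%N /\ lambda P ≅ 'I_m.+1).
Proof.
split; last by move=> d P m; exact: lambda_infinite.
move=> [|[|[|[|n]]]]// _.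
pose bot : 'I_n.+4 := ord0; pose top : 'I_n.+4 := ord_max.
pose u : 'I_n.+4 := Ordinal (isT : (1 < n.+4)%N).
pose v : 'I_n.+4 := Ordinal (isT : (2 < n.+4)%N).
have botP : is_bot bot by [].
have topP : is_top top by move=> x; rewrite leEord; exact: leq_ord.
have bu : bot < u by [].
have uv : u < v by [].
have vt : v < top by [].
have ui : interior u by split; [exact: lt_not_bot bu|exact: lt_not_top uv].
split.
- by rewrite -(nb_endpoints2 botP topP); exact: lambda_iso ui.
- exact: Lambda_iso botP topP bu (lt_trans uv vt).
rewrite -(nb_endpoints2 botP topP).
by apply: L_iso botP topP bu uv vt => h; exact: attains_bounds_finite 0%R h.
Qed.
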